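(* Let $\psi:[0,1]\to\mathbb{R}$ be a continuous function belonging to $H^1(0,1)$, satisfying $\psi(0)=0$, $\psi(1)=1$, $\int_0^1(1-x)\,\psi(x)\,dx=0$, and such that there exists $\theta\in\,]0,1[$ with $\psi(\theta)+\psi(1-\theta)\neq1$. Then for any family $\mathcal U_{\alpha,\beta}$ of uniformly regular meshes the uniform discrete inf-sup condition is not satisfied for the spaces $U_{\mathcal T}\times P_{\mathcal T}$ and $U_{\mathcal T}\times Q^\psi_{\mathcal T}$; that is: for all $(\alpha,\beta)$ with $0<\alpha<1<\beta$ and all $D>0$, there exist $\mathcal T\in\mathcal U_{\alpha,\beta}$ and $\xi\in U_{\mathcal T}\times P_{\mathcal T}$ with $\|\xi\|_V=1$ such that $$\forall\,\eta\in U_{\mathcal T}\times Q^\psi_{\mathcal T},\qquad \|\eta\|_V\le1\ \Longrightarrow\ \gamma(\xi,\eta)\le D .$$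
   Context: Norms: $(\cdot,\cdot)$ and $\|\cdot\|_0$ are the scalar product and norm of $L^2(0,1)$; in one dimension $\mathrm{div}\,q=q'$. On $V=L^2(0,1)\times H^1(0,1)$ the norm is $\|(v,q)\|_V=(\|v\|_0^2+\|q\|_0^2+\|\mathrm{div}\,q\|_0^2)^{1/2}$. Meshes: a mesh $\mathcal T$ with $n=n_{\mathcal T}\ge1$ elements is a set of vertices $0=x_0<x_1<\dots<x_n=1$; its elements are $]x_j,x_{j+1}[$, with lengths $h_{j+1/2}=x_{j+1}-x_j$ ($0\le j\le n-1$). For $0<\alpha<1<\beta$, $\mathcal U_{\alpha,\beta}$ is the class of all meshes such that $\alpha/n_{\mathcal T}\le h_{j+1/2}\le\beta/n_{\mathcal T}$ for all $j=0,\dots,n_{\mathcal T}-1$. Discrete spaces: $U_{\mathcal T}$ is the space of functions that are constant on each element. $P_{\mathcal T}$ is the space of continuous functions on $[0,1]$ that are affine on each element. $Q^\psi_{\mathcal T}$ is the linear span of the functions $\psi_0,\dots,\psi_n$ on $[0,1]$ defined by $\psi_j(x)=\psi\big(\frac{x-x_{j-1}}{h_{j-1/2}}\big)$ if $x_{j-1}\le x\le x_j$, $\psi_j(x)=\psi\big(\frac{x_{j+1}-x}{h_{j+1/2}}\big)$ if $x_j\le x\le x_{j+1}$, and $\psi_j(x)=0$ elsewhere (for $j=0$ and $j=n$ only the piece lying in $[0,1]$ is used). Bilinear form: $\gamma((u,p),(v,q))=(p,q)+(u,\mathrm{div}\,q)+(\mathrm{div}\,p,v)$. *)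

(* Defs.v *)
From HB Require Import structures.
From mathcomp Require Import all_boot all_order all_algebra.
From mathcomp Require Import all_classical all_reals all_analysis.

Set Implicit Arguments.
Unset Strict Implicit.
Unset Printing Implicit Defensive.

Import Order.TTheory GRing.Theory Num.Theory.
Import numFieldNormedType.Exports.

Local Open Scope classical_set_scope.
Local Open Scope ring_scope.

(* Functions on ]0,1[ or [0,1] are represented by total functions R -> R whose
   values outside the interval are irrelevant; only test functions are
   genuinely functions on the whole line. *)

Definition dot0 (R : realType) (f g : R -> R) : R :=
  (\int[lebesgue_measure]_(x in `](0 : R), (1 : R)[) (f x * g x))%R.

Definition norm0 (R : realType) (f : R -> R) : R := Num.sqrt (dot0 f f).

Definition L2 (R : realType) (f : R -> R) : Prop :=
  measurable_fun `](0 : R), (1 : R)[ f /\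
  lebesgue_measure.-integrable `](0 : R), (1 : R)[ (fun x => ((f x) ^+ 2)%:E).

Definition C1c (R : realType) (phi : R -> R) : Prop :=
  [/\ forall x : R, derivable phi x 1,
      continuous (derive1 phi)
    & exists a b : R, [/\ 0 < a, b < 1 & forall x : R, x \notin `[a, b] -> phi x = 0]].

(* g is a square-integrable weak derivative of u on ]0,1[. As in Brezis,
   Functional Analysis, Sobolev Spaces and PDE, section 8.2, the test functions
   are those of class C^1 with compact support. *)
Definition is_weak_deriv (R : realType) (u g : R -> R) : Prop :=
  L2 g /\ forall phi, C1c phi -> dot0 u (derive1 phi) = - dot0 g phi.

Definition H1 (R : realType) (u : R -> R) : Prop :=
  L2 u /\ exists g, is_weak_deriv u g.

(* A weak derivative is only determined almost everywhere: an arbitrary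
   representative is chosen. The value is junk (zero) when u is not in H^1. *)
Definition div1 (R : realType) (u : R -> R) : R -> R :=
  xget (fun=> 0) [set g | is_weak_deriv u g].

Definition normV (R : realType) (eta : (R -> R) * (R -> R)) : R :=
  Num.sqrt (norm0 eta.1 ^+ 2 + norm0 eta.2 ^+ 2 + norm0 (div1 eta.2) ^+ 2).

Definition gamma_form (R : realType) (xi eta : (R -> R) * (R -> R)) : R :=
  dot0 xi.2 eta.2 + dot0 xi.1 (div1 eta.2) + dot0 (div1 xi.2) eta.1.

(* Only the vertices of index at most nelt are meaningful. *)
Record mesh (R : realType) := Mesh {
  nelt : nat;
  vtx : nat -> R;
  nelt_gt0 : (0 < nelt)%N;
  vtx_first : vtx 0 = 0;
  vtx_last : vtx nelt = 1;
  vtx_lt : forall j, (j < nelt)%N -> vtx j < vtx j.+1 }.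

(* h_{j+1/2} *)
Definition hstep (R : realType) (T : mesh R) (j : nat) : R :=
  vtx T j.+1 - vtx T j.

Definition unif_regular (R : realType) (alpha beta : R) : set (mesh R) :=
  [set T | forall j, (j < nelt T)%N ->
     alpha / (nelt T)%:R <= hstep T j <= beta / (nelt T)%:R].

Definition U_space (R : realType) (T : mesh R) : set (R -> R) :=
  [set u | forall j, (j < nelt T)%N ->
     exists c : R, forall x : R, x \in `]vtx T j, vtx T j.+1[ -> u x = c].

Definition P_space (R : realType) (T : mesh R) : set (R -> R) :=
  [set p | {within `[(0 : R), (1 : R)], continuous p} /\
     forall j, (j < nelt T)%N ->
     exists a b : R, forall x : R, x \in `]vtx T j, vtx T j.+1[ -> p x = a * x + b].

Definition psi_basis (R : realType) (psi : R -> R) (T : mesh R) (j : nat)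
    (x : R) : R :=
  if (0 < j)%N && (vtx T j.-1 <= x <= vtx T j) then
    psi ((x - vtx T j.-1) / hstep T j.-1)
  else if (j < nelt T)%N && (vtx T j <= x <= vtx T j.+1) then
    psi ((vtx T j.+1 - x) / hstep T j)
  else 0.

Definition Q_space (R : realType) (psi : R -> R) (T : mesh R) : set (R -> R) :=
  [set q | exists c : 'I_(nelt T).+1 -> R,
     forall x : R, x \in `[(0 : R), (1 : R)] -> q x = \sum_j c j * psi_basis psi T j x].

(* Main.v *)
Require Import Defs.
From HB Require Import structures.
From mathcomp Require Import all_boot all_order all_algebra.
From mathcomp Require Import all_classical all_reals all_analysis.
From mathcomp Require Import measurable_realfun zify ring lra.

(** The failure of the inf-sup condition is witnessed by the simplest pair,
    xi = (1, 0), on a uniform mesh with many elements.  For eta = (v, q) the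
    form gamma(xi, eta) reduces to the integral of div q over ]0,1[, that is to
    q(1) - q(0), so it is enough to show that the functions of Q^psi whose
    derivative has norm at most 1 are small at the vertices.

    On an element [a,b] of length h such a function is
    q(x) = q(a) psi((b-x)/h) + q(b) psi((x-a)/h).
    Adding its values at the two symmetric points a + theta h and b - theta h
    gives (q(a) + q(b)) (psi(theta) + psi(1-theta)).  Since H^1 functions are
    1/2-Hoelder, all the values of q on the element agree up to sqrt h, so this
    sum also equals q(a) + q(b) up to 2 sqrt h.  As psi(theta) + psi(1-theta)
    differs from 1, |q(a) + q(b)| is O(sqrt h); and |q(a) - q(b)| is at most
    sqrt h, hence both q(a) and q(b) are O(sqrt h) ([endpoint_bound]).
    In other words, on an element the span of the two psi profiles contains no
    nonzero constant, so that any value which is not small there costs a large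
    derivative.

    The analytic content is the fundamental theorem of calculus for a
    continuous function with a square-integrable weak derivative ([weak_FTC]),
    obtained by testing against explicit C^1 quadratic splines that
    approximate the indicator of an interval.  It yields the Hoelder estimate
    through the Cauchy-Schwarz inequality ([weak_deriv_holder]), and the almost
    everywhere uniqueness of the weak derivative of 0 ([weak_deriv0_ae]), which
    makes the arbitrary representative chosen for div 0 harmless.  If q has no
    weak derivative at all, div q is 0 by convention and gamma vanishes. *)

Set Implicit Arguments.
Unset Strict Implicit.
Unset Printing Implicit Defensive.

Import Order.TTheory GRing.Theory Num.Theory.
Import numFieldNormedType.Exports.

Local Open Scope classical_set_scope.
Local Open Scope ring_scope.

(** * Square-integrable functions on the unit interval *)

Section square_integrable.
Context {R : realType}.
Local Notation mu := (@lebesgue_measure R).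
Implicit Types (f g : R -> R) (a b : R).

Lemma L2_mul_integrable f g : L2 f -> L2 g ->
  mu.-integrable `]0, 1[ (EFin \o (fun x => f x * g x)).
Proof.
move=> [mf f2] [mg g2].
apply: (@le_integrable _ _ _ mu _ _ _ (fun x => (f x ^+ 2)%:E + (g x ^+ 2)%:E)%E) => //.
- by apply/measurable_EFinP; apply: measurable_funM.
- move=> x _ /=; rewrite lee_fin [leRHS]ger0_norm ?addr_ge0 ?sqr_ge0//.
  rewrite normrM -(real_normK (num_real (f x))) -(real_normK (num_real (g x))).
  nra.
- exact: integrableD.
Qed.

Lemma norm0_ge0 f : 0 <= norm0 f.
Proof. exact: sqrtr_ge0. Qed.

Lemma dot0_ge0 f : 0 <= dot0 f f.
Proof. by apply: Rintegral_ge0 => x _; rewrite -expr2 sqr_ge0. Qed.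

Lemma norm0_sqr f : norm0 f ^+ 2 = dot0 f f.
Proof. by rewrite sqr_sqrtr ?dot0_ge0. Qed.

Lemma L2_cst c : L2 (fun=> c : R).
Proof.
split; first exact: measurable_cst.
apply: measurable_bounded_integrable => //.
- by rewrite /= lebesgue_measure_itv/= lte_fin ltr01 -EFinD ltry.
- exact: bounded_cst.
Qed.

Lemma L2_bounded f (M : R) : measurable_fun `](0 : R), (1 : R)[ f ->
  (forall x, `|f x| <= M) -> L2 f.
Proof.
move=> mf fM; split=> //.
have [_ +] := L2_cst M; apply: le_integrable => //.
  by apply/measurable_EFinP; apply: measurable_funX.
move=> x _; rewrite /= lee_fin !normrX ler_sqr ?nnegrE//.
by rewrite (le_trans (fM x))// ler_norm.
Qed.

Lemma L2_integrable g : L2 g -> mu.-integrable `]0, 1[ (EFin \o g).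
Proof.
move=> Lg; have := L2_mul_integrable (L2_cst 1) Lg.
by under [X in EFin \o X]eq_fun do rewrite mul1r.
Qed.

Lemma dot0Br f g h : L2 f -> L2 g -> L2 h ->
  dot0 f (fun x => g x - h x) = dot0 f g - dot0 f h :> R.
Proof.
move=> Lf Lg Lh; rewrite /dot0 -RintegralB//; try exact: L2_mul_integrable.
by apply: eq_Rintegral => x _; rewrite mulrBr.
Qed.

Lemma dot0_lin_sqr s t f g : L2 f -> L2 g ->
  dot0 (fun x => s * f x - t * g x) (fun x => s * f x - t * g x) =
  s ^+ 2 * dot0 f f - 2 * s * t * dot0 f g + t ^+ 2 * dot0 g g.
Proof.
move=> Lf Lg; have iff := L2_mul_integrable Lf Lf.
have igg := L2_mul_integrable Lg Lg; have ifg := L2_mul_integrable Lf Lg.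
have ZI c (h : R -> R) : mu.-integrable `]0, 1[ (EFin \o h) ->
    mu.-integrable `]0, 1[ (EFin \o (fun x => c * h x)).
  by move=> ih; apply: (integrableZl _ c ih) => //; exact: measurable_itv.
rewrite /dot0 -!RintegralZl// -RintegralB//; [|exact: ZI..].
rewrite -RintegralD//; [|exact: (integrableB _ (ZI _ _ iff) (ZI _ _ ifg))|exact: ZI].
by apply: eq_Rintegral => x _; ring.
Qed.

(** The squared norm of s f - t g is a nonnegative quadratic form in (s,t); its
    value at (C, B), where C = (g,g) and B = (f,g), is C times the gap to be
    bounded. *)
Lemma cauchy_schwarz0 f g : L2 f -> L2 g -> `|dot0 f g| <= norm0 f * norm0 g.
Proof.
move=> Lf Lg; rewrite -(@ler_pXn2r _ 2)// ?nnegrE ?mulr_ge0 ?norm0_ge0//.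
rewrite exprMn !norm0_sqr real_normK ?num_real//.
set A := dot0 f f; set B := dot0 f g; set C := dot0 g g.
have A0 : 0 <= A := dot0_ge0 f.
have quad s t : 0 <= s ^+ 2 * A - 2 * s * t * B + t ^+ 2 * C.
  by rewrite -dot0_lin_sqr// dot0_ge0.
have : 0 <= C := dot0_ge0 g; rewrite le_eqVlt => /predU1P[C0|C0].
(* When C = 0 the form at (1, t) is affine in t, and this t gives it the value - 1. *)
- rewrite -C0 mulr0; have [->|B0] := eqVneq B 0; first by rewrite expr0n.
  have := quad 1 ((A + 1) / (2 * B)); rewrite -C0.
  have -> : 1 ^+ 2 * A - 2 * 1 * ((A + 1) / (2 * B)) * B + ((A + 1) / (2 * B)) ^+ 2 * 0 = - 1 by field.
  by rewrite ler0N1.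
- have := quad C B.
  have -> : C ^+ 2 * A - 2 * C * B * B + B ^+ 2 * C = C * (A * C - B ^+ 2) by ring.
  by rewrite pmulr_rge0// subr_ge0.
Qed.

Lemma L2_indic a b : L2 (\1_`[a, b] : R -> R).
Proof.
apply: (@L2_bounded _ 1).
  by apply: measurable_funTS; exact: measurable_indic.
by move=> x; rewrite indicE; case: (_ \in _); rewrite ?normr0 ?normr1.
Qed.

Lemma dot0_indic_le a b : a <= b -> dot0 (\1_`[a, b] : R -> R) \1_`[a, b] <= b - a.
Proof.
move=> ab; rewrite /dot0.
have -> : (\int[mu]_(x in `]0, 1[) (\1_`[a, b] x * \1_`[a, b] x : R))%R =
    fine (mu (`[a, b] `&` `]0, 1[)).
  rewrite -integral_indic//; congr fine; apply: eq_integral => x _.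
  by rewrite indicE; case: (_ \in _); rewrite ?mulr1 ?mulr0.
rewrite -[leRHS]/(fine (b - a)%:E) fine_le//.
- rewrite ge0_fin_numE//; apply: le_lt_trans (_ : (mu `[a, b] < +oo)%E).
    by apply: le_measure; rewrite ?inE//; apply: measurableI.
  by rewrite lebesgue_measure_itv/=; case: ifP; rewrite ?ltry.
- apply: le_trans (_ : (mu `[a, b] <= _)%E).
    by apply: le_measure; rewrite ?inE//; apply: measurableI.
  rewrite lebesgue_measure_itv/= lte_fin; case: ifP => //= _.
  by rewrite lee_fin subr_ge0.
Qed.

Lemma dot0_indic_bound g a b : L2 g -> a <= b ->
  `|dot0 g \1_`[a, b]| <= norm0 g * Num.sqrt (b - a).
Proof.
move=> Lg ab; apply: le_trans (cauchy_schwarz0 Lg (L2_indic a b)) _.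
by rewrite ler_wpM2l ?norm0_ge0// ler_wsqrtr// dot0_indic_le.
Qed.

End square_integrable.

(** * Quadratic-spline ramps and their tent-shaped derivatives *)

Section ramp.
Context {R : realType}.
Implicit Types (c d x : R).

(** A uniform quadratic remainder spares the case analysis that differentiating
    max(t,0)^2 at 0 would require. *)
Lemma is_derive_quadratic_remainder (f : R -> R) x l :
  (forall h, `|f (h + x) - f x - l * h| <= h ^+ 2) -> is_derive x 1 f l.
Proof.
move=> fq.
suff fl : h^-1 *: (f (h *: 1 + x) - f x) @[h --> 0^'] --> l.
  by apply: DeriveDef; [exact: cvgP fl|exact: cvg_lim fl].
apply/cvgrPdist_le => e e0; near=> h.
have h0 : h != 0 by near: h; exact: nbhs_dnbhs_neq.
have he : `|h| <= e by near: h; exact: dnbhs0_le.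
rewrite [h%:A]mulr1 -[_ *: _]/(h^-1 * _).
have -> : l - h^-1 * (f (h + x) - f x) = - h^-1 * (f (h + x) - f x - l * h) by field.
rewrite normrM normrN normfV mulrC ler_pdivrMr ?normr_gt0//.
apply: le_trans (fq h) _; rewrite -(real_normK (num_real h)) expr2.
by rewrite ler_wpM2r.
Unshelve. all: by end_near. Qed.

Let pos x := Num.max x 0.

Lemma is_derive_sqr_pos c x :
  is_derive x 1 (fun t => pos (t - c) ^+ 2) (2 * pos (x - c)).
Proof.
apply: is_derive_quadratic_remainder => h; rewrite /pos -(addrA h).
move: (x - c) => y; rewrite ler_norml.
by case: (leP (h + y) 0) => ?; case: (leP y 0) => ?; apply/andP; split; nra.
Qed.

(** The second difference, of step d, of the C^1 function t |-> max(t,0)^2,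
    scaled so as to be a C^1 transition from 0 to 1 across [c, c + 2 d]. *)
Definition ramp c d x : R :=
  (pos (x - c) ^+ 2 - 2 * pos (x - (c + d)) ^+ 2 + pos (x - (c + 2 * d)) ^+ 2)
  / (2 * d ^+ 2).

Definition tent c d x : R :=
  (pos (x - c) - 2 * pos (x - (c + d)) + pos (x - (c + 2 * d))) / d ^+ 2.

Lemma is_derive_ramp c d x : d != 0 -> is_derive x 1 (ramp c d) (tent c d x).
Proof.
move=> d0.
pose sq (e t : R) : R := pos (t - e) ^+ 2.
have -> : ramp c d = (2 * d ^+ 2)^-1 \*: (sq c - 2 \*: sq (c + d) + sq (c + 2 * d)).
  by apply/funext => t; rewrite /ramp mulrC.
have D e : is_derive x 1 (sq e) (2 * pos (x - e)) := is_derive_sqr_pos e x.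
have := is_deriveZ (2 * d ^+ 2)^-1
  (is_deriveD (is_deriveB (D c) (is_deriveZ 2 (D (c + d)))) (D (c + 2 * d))).
move=> H; apply: (is_derive_eq H).
by rewrite /tent -![_ *: _]/(_ * _); field.
Qed.

Lemma continuous_tent c d : continuous (tent c d).
Proof.
have cp e : continuous (fun x => pos (x - e)).
  move=> x; apply: (@continuous_max _ _ (fun t : R => t - e) (cst 0)).
    by apply: cvgB; [exact: cvg_id|exact: cvg_cst].
  exact: cvg_cst.
move=> x; apply: cvgM; last exact: cvg_cst.
apply: cvgD; last exact: cp.
by apply: cvgB; [exact: cp|apply: cvgM; [exact: cvg_cst|exact: cp]].
Qed.

Lemma ramp_eq0 c d x : 0 < d -> x <= c -> ramp c d x = 0.
Proof.
move=> d0 xc; rewrite /ramp /pos !max_r; [by rewrite expr0n/= !mulr0 subrr addr0 mul0r|lra..].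
Qed.

(** To the right of c + 2 d all three terms are squares without truncation, and
    the second difference of t^2 is 2 d^2. *)
Lemma ramp_eq1 c d x : 0 < d -> c + 2 * d <= x -> ramp c d x = 1.
Proof.
move=> d0 xc; rewrite /ramp /pos !max_l; [by field; lra|lra..].
Qed.

Lemma ramp_bounds c d x : 0 < d -> 0 <= ramp c d x <= 1.
Proof.
move=> d0; have B : 0 < 2 * d ^+ 2 by nra.
suff /andP[N0 N1] : 0 <= pos (x - c) ^+ 2 - 2 * pos (x - (c + d)) ^+ 2
    + pos (x - (c + 2 * d)) ^+ 2 <= 2 * d ^+ 2.
  by rewrite /ramp divr_ge0 ?(ltW B)//= ler_pdivrMr// mul1r.
rewrite /pos.
by case: (leP (x - c) 0) => ?; case: (leP (x - (c + d)) 0) => ?;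
  case: (leP (x - (c + 2 * d)) 0) => ?; apply/andP; split; nra.
Qed.

Lemma tent_ge0 c d x : 0 < d -> 0 <= tent c d x.
Proof.
move=> d0; rewrite /tent divr_ge0 ?sqr_ge0// /pos.
by case: (leP (x - c) 0) => ?; case: (leP (x - (c + d)) 0) => ?;
  case: (leP (x - (c + 2 * d)) 0) => ?; lra.
Qed.

Lemma tent_eq0 c d x : 0 < d -> x \notin `]c, c + 2 * d[ -> tent c d x = 0.
Proof.
rewrite in_itv/= negb_and -!leNgt /tent /pos => d0 /orP xI.
suff -> : Num.max (x - c) 0 - 2 * Num.max (x - (c + d)) 0 +
    Num.max (x - (c + 2 * d)) 0 = 0 by rewrite mul0r.
by case: (leP (x - c) 0) => ?; case: (leP (x - (c + d)) 0) => ?;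
  case: (leP (x - (c + 2 * d)) 0) => ?; lra.
Qed.

Lemma is_derive_ramp_sub c c' d x : 0 < d ->
  is_derive x 1 (fun x => ramp c d x - ramp c' d x) (tent c d x - tent c' d x).
Proof.
by move=> d0; apply: is_deriveB; apply: is_derive_ramp; rewrite gt_eqF.
Qed.

Lemma continuous_ramp_sub c c' d : 0 < d ->
  continuous (fun x : R => ramp c d x - ramp c' d x).
Proof.
move=> d0 x; apply: differentiable_continuous; apply/derivable1_diffP.
by case: (is_derive_ramp_sub c c' x d0).
Qed.

(** Going up along a first ramp and down along a second one gives a plateau: the
    C^1 substitute for an indicator function among the test functions. *)
Lemma C1c_ramp_sub c c' d : 0 < d -> 0 < c -> c + 2 * d <= c' -> c' + 2 * d < 1 ->
  C1c (fun x => ramp c d x - ramp c' d x) /\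
  derive1 (fun x => ramp c d x - ramp c' d x) = (fun x => tent c d x - tent c' d x).
Proof.
move=> d0 c0 cc' c'1.
have D x := is_derive_ramp_sub c c' x d0.
have E : derive1 (fun x => ramp c d x - ramp c' d x) = (fun x => tent c d x - tent c' d x).
  by apply/funext => x; rewrite derive1E derive_val.
split=> //; split.
- by move=> x; apply: ex_derive.
- by rewrite E => x; apply: cvgB; exact: continuous_tent.
- exists c, (c' + 2 * d); split=> // x; rewrite in_itv/= negb_and -!ltNge => /orP[xc|xc].
    by rewrite !ramp_eq0 ?subrr//; lra.
  by rewrite !ramp_eq1 ?subrr//; lra.
Qed.

End ramp.

(** * The fundamental theorem of calculus for weak derivatives *)

Section weak_derivative.
Context {R : realType}.
Local Notation mu := (@lebesgue_measure R).
Implicit Types (f g q : R -> R) (a b c d e x y : R).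

Lemma within_continuous_dist f a b x e : {within `[a, b], continuous f} ->
  x \in `[a, b] -> 0 < e ->
  \forall d \near 0^'+, forall y, y \in `[a, b] -> `|y - x| <= d -> `|f y - f x| <= e.
Proof.
move=> /subspace_continuousP fc xab e0.
have /cvgrPdist_le /(_ e e0) := fc x xab.
rewrite near_withinE => /nbhs_ballP[r /= r0 rf].
near=> d => y yab yxd; rewrite distrC; apply: rf => //=.
rewrite /ball/= distrC; apply: le_lt_trans yxd _. near: d.
exact: nbhs_right_lt.
Unshelve. all: by end_near. Qed.

Lemma integrable_dot_continuous f g : {within `[(0 : R), 1], continuous f} ->
  continuous g -> mu.-integrable `]0, 1[ (EFin \o (fun x => f x * g x)).
Proof.
move=> fc gc.
apply: (@integrableS _ _ _ mu `[0, 1]) => //.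
  exact: subset_itv_oo_cc.
apply: continuous_compact_integrable; first exact: segment_compact.
move=> x; apply: cvgM; first exact: fc.
exact: (continuous_subspaceT gc).
Qed.

(** A tent has mass 1, being the derivative of a ramp. *)
Lemma dot0_cst_tent l c d : 0 < d -> 0 <= c -> c + 2 * d <= 1 ->
  dot0 (fun=> l) (tent c d) = l.
Proof.
move=> d0 c0 c1; rewrite /dot0 RintegralZl//; last first.
  have := @integrable_dot_continuous (fun=> 1) (tent c d) _ (@continuous_tent _ c d).
  under [X in EFin \o X]eq_fun do rewrite mul1r; apply.
  by apply: continuous_subspaceT => x; exact: cvg_cst.
rewrite /Rintegral -(@integral_itv_bndoo _ 0 1 _ true false); last first.
  apply/measurable_EFinP/measurable_funTS.
  by apply: continuous_measurable_fun; exact: continuous_tent.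
have dr x : derivable (ramp c d) x 1.
  by have := is_derive_ramp c x (lt0r_neq0 d0); case.
have cr x : {for x, continuous (ramp c d)}.
  by apply: differentiable_continuous; apply/derivable1_diffP.
rewrite (@continuous_FTC2 _ _ (ramp c d))//.
- by rewrite ramp_eq1// ramp_eq0//= subr0 mulr1.
- by apply: continuous_subspaceT; exact: continuous_tent.
- split; first by move=> x _; exact: dr.
  + exact: cvg_at_right_filter (cr 0).
  + exact: cvg_at_left_filter (cr 1).
- move=> x _; rewrite derive1E.
  by have D := is_derive_ramp c x (lt0r_neq0 d0); rewrite derive_val.
Qed.

(** A tent is a probability density: the average of q against it is as close to
    l as the values of q on the support. *)
Lemma dot0_tent_near q l e c d : {within `[(0 : R), 1], continuous q} ->
  0 < d -> 0 <= c -> c + 2 * d <= 1 ->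
  (forall x, x \in `[c, c + 2 * d] -> `|q x - l| <= e) ->
  `|dot0 q (tent c d) - l| <= e.
Proof.
move=> qc d0 c0 c1 qe; have tc := @continuous_tent _ c d.
have cstc r : {within `[(0 : R), 1], continuous (fun=> r : R)}.
  by apply: continuous_subspaceT => x; exact: cvg_cst.
have qlc : {within `[(0 : R), 1], continuous (fun x => q x - l)}.
  by move=> x; apply: cvgB; [exact: qc|exact: cvg_cst].
rewrite -(dot0_cst_tent l d0 c0 c1) /dot0 -RintegralB//; last 2 first.
  exact: integrable_dot_continuous.
  exact: integrable_dot_continuous.
have iql := integrable_dot_continuous qlc tc.
under eq_Rintegral do rewrite -mulrBl.
apply: le_trans (le_normr_Rintegral _ iql) _ => //.
rewrite -[leRHS](dot0_cst_tent e d0 c0 c1); apply: le_Rintegral => //.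
- by have := integrable_abse iql.
- exact: integrable_dot_continuous.
- move=> x _; rewrite normrM (ger0_norm (tent_ge0 _ _ d0)).
  have [xI|xI] := boolP (x \in `]c, c + 2 * d[).
    by rewrite ler_wpM2r ?tent_ge0// qe// (subset_itv_oo_cc xI).
  by rewrite tent_eq0// !mulr0.
Qed.

(** The plateau and the indicator of [a,b] differ only within 3 d of the
    endpoints, and by at most 1 there.  The foot of each ramp is kept at
    distance d from the endpoints so that the plateau has compact support in
    ]0,1[ even when a = 0 or b = 1. *)
Lemma dot0_plateau_le a b d : 0 < d -> a + 3 * d <= b - 3 * d ->
  let r x := (\1_`[a, b] x - (ramp (a + d) d x - ramp (b - 3 * d) d x)) : R in
  L2 r /\ dot0 r r <= 6 * d.
Proof.
move=> d0 abd r.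
have Lr : L2 r.
  apply: (@L2_bounded _ _ 2).
    apply: measurable_funB; apply: measurable_funTS; first exact: measurable_indic.
    by apply: continuous_measurable_fun; exact: continuous_ramp_sub.
  move=> x; rewrite /r; have := ramp_bounds (a + d) x d0.
  have := ramp_bounds (b - 3 * d) x d0.
  by rewrite indicE ler_norml; case: (_ \in _) => /= /andP[? ?] /andP[? ?]; apply/andP; split; lra.
split=> //.
pose i1 : R -> R := \1_`[a, a + 3 * d]; pose i2 : R -> R := \1_`[b - 3 * d, b].
have L1 : L2 i1 := L2_indic _ _; have L2' : L2 i2 := L2_indic _ _.
apply: (@le_trans _ _ (dot0 i1 i1 + dot0 i2 i2)); last first.
  have H1 := @dot0_indic_le R a (a + 3 * d) ltac:(lra).
  have H2 := @dot0_indic_le R (b - 3 * d) b ltac:(lra).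
  by rewrite /i1 /i2; lra.
have int1 := L2_mul_integrable L1 L1; have int2 := L2_mul_integrable L2' L2'.
rewrite /dot0 -RintegralD//; apply: le_Rintegral => //.
- exact: L2_mul_integrable.
- by have := integrableD _ int1 int2; apply.
move=> x _; rewrite /r /i1 /i2 !indicE !mem_setE !in_itv/=.
have := ramp_bounds (a + d) x d0; have := ramp_bounds (b - 3 * d) x d0.
have := @ramp_eq0 _ (a + d) d x d0; have := @ramp_eq1 _ (a + d) d x d0.
have := @ramp_eq0 _ (b - 3 * d) d x d0; have := @ramp_eq1 _ (b - 3 * d) d x d0.
move: (ramp (a + d) d x) (ramp (b - 3 * d) d x) => u v v1 v0 u1 u0 /andP[v0' v1'] /andP[u0' u1'].
case: (leP a x) => ax; case: (leP x b) => xb; case: (leP x (a + 3 * d)) => xa3;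
  case: (leP (b - 3 * d) x) => xb3 /=; try lra.
- rewrite v0; nra.
- rewrite v0; nra.
- rewrite u1; nra.
- rewrite v0 ?u1; nra.
- rewrite v1 ?u1; nra.
- rewrite u0 ?v0; nra.
Qed.

(** Tested against a plateau, the left-hand side of the definition of the
    weak derivative is a difference of averages of q near a and near b, and the
    right-hand side is close in L^2 to the integral of g over [a,b]. *)
Lemma weak_FTC q g a b : {within `[(0 : R), 1], continuous q} ->
  is_weak_deriv q g -> 0 <= a -> a < b -> b <= 1 ->
  dot0 g \1_`[a, b] = q b - q a.
Proof.
move=> qc [Lg qg] a0 ab b1; apply/eqP; rewrite -subr_eq0 -normr_le0.
apply/ler_addgt0Pr => e e0; rewrite add0r.
have e3 : 0 < e / 3 by rewrite divr_gt0.
have aI : a \in `[(0 : R), 1] by rewrite in_itv/=; lra.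
have bI : b \in `[(0 : R), 1] by rewrite in_itv/=; lra.
pose N := norm0 g + 1.
have N0 : 0 < N by rewrite /N; have := norm0_ge0 g; lra.
near (0 : R)^'+ => t.
have t0 : 0 < t by near: t; exact: nbhs_right_gt.
(* The transition zones at the ends of [a,b], each of width 3 d, must be disjoint. *)
pose d := t / 6.
have d0 : 0 < d by rewrite divr_gt0.
have tab : t <= b - a by near: t; apply: nbhs_right_le; rewrite subr_gt0.
have qa y : y \in `[(0 : R), 1] -> `|y - a| <= t -> `|q y - q a| <= e / 3.
  by move: y; near: t; exact: within_continuous_dist.
have qb y : y \in `[(0 : R), 1] -> `|y - b| <= t -> `|q y - q b| <= e / 3.
  by move: y; near: t; exact: within_continuous_dist.
have tN : Num.sqrt t <= e / 3 / N.
  have tN2 : t <= (e / 3 / N) ^+ 2.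
    by near: t; apply: nbhs_right_le; rewrite exprn_gt0// divr_gt0.
  by apply: le_trans (ler_wsqrtr tN2) _; rewrite sqrtr_sqr ger0_norm// divr_ge0 ?ltW.
have dt : t = 6 * d by rewrite /d; field.
pose phi x := ramp (a + d) d x - ramp (b - 3 * d) d x.
have [|Lr r6] := @dot0_plateau_le a b d d0; first lra.
have [|||phiC phi'] := @C1c_ramp_sub R (a + d) (b - 3 * d) d d0; [lra..|].
have Lphi : L2 phi.
  apply: (@L2_bounded _ _ 1).
    by apply: measurable_funTS; apply: continuous_measurable_fun; exact: continuous_ramp_sub.
  move=> x; have := ramp_bounds (a + d) x d0; have := ramp_bounds (b - 3 * d) x d0.
  by rewrite /phi ler_norml; lra.
have E1 : `|dot0 g \1_`[a, b] - dot0 g phi| <= e / 3.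
  rewrite -dot0Br//; last exact: L2_indic.
  apply: le_trans (cauchy_schwarz0 Lg Lr) _.
  apply: (@le_trans _ _ (N * (e / 3 / N))); last by rewrite mulrC divfK// gt_eqF.
  apply: ler_pM; rewrite ?norm0_ge0//; first by rewrite /N lerDl.
  by apply: le_trans tN; rewrite ler_wsqrtr// dt.
have E2 : dot0 g phi = dot0 q (tent (b - 3 * d) d) - dot0 q (tent (a + d) d).
  have := qg _ phiC; rewrite phi' => qphi.
  rewrite -[LHS]opprK -qphi /dot0; under eq_Rintegral do rewrite mulrBr.
  rewrite RintegralB//; first by rewrite opprB.
    by apply: integrable_dot_continuous => //; exact: continuous_tent.
  by apply: integrable_dot_continuous => //; exact: continuous_tent.
have E3 : `|dot0 q (tent (b - 3 * d) d) - q b| <= e / 3.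
  apply: dot0_tent_near; rewrite //; try lra.
  move=> x; rewrite in_itv/= => xI; apply: qb; first by rewrite in_itv/=; lra.
  by rewrite ler_norml; lra.
have E4 : `|dot0 q (tent (a + d) d) - q a| <= e / 3.
  apply: dot0_tent_near; rewrite //; try lra.
  move=> x; rewrite in_itv/= => xI; apply: qa; first by rewrite in_itv/=; lra.
  by rewrite ler_norml; lra.
move: E1 E3 E4; rewrite E2 !ler_norml; lra.
Unshelve. all: by end_near. Qed.

(** Cauchy-Schwarz applied to the integral of g between x and y. *)
Lemma weak_deriv_holder q g a b x y : {within `[(0 : R), 1], continuous q} ->
  is_weak_deriv q g -> 0 <= a -> b <= 1 -> x \in `[a, b] -> y \in `[a, b] ->
  `|q y - q x| <= norm0 g * Num.sqrt (b - a).
Proof.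
move=> qc qg a0 b1; wlog xy : x y / x <= y => [W xab yab|].
  have [xy|/ltW yx] := leP x y; first exact: W.
  by rewrite distrC; exact: W.
rewrite !in_itv/= => xab yab.
have [->|nxy] := eqVneq x y.
  by rewrite subrr normr0 mulr_ge0 ?sqrtr_ge0// norm0_ge0.
have {nxy} xy' : x < y by rewrite lt_neqAle nxy.
have [Lg _] := qg.
rewrite -(weak_FTC qc qg _ xy'); try lra.
apply: le_trans (dot0_indic_bound Lg xy) _.
by rewrite ler_wpM2l ?norm0_ge0// ler_wsqrtr//; lra.
Qed.

(** By [weak_FTC] the integral of g over every subinterval of [0,1] vanishes, so
    the indefinite integral of g, whose derivative is g almost everywhere, is 0. *)
Lemma weak_deriv0_ae g : is_weak_deriv (fun=> 0) g ->
  {ae mu, forall x, x \in `]0, 1[ -> g x = 0}.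
Proof.
move=> g0; have [Lg _] := g0; have ig := L2_integrable Lg.
pose f : R -> R := g \_ `](0 : R), 1[%classic.
have intf : mu.-integrable setT (EFin \o f).
  rewrite /f; have := ig; rewrite integrable_mkcond//.
  by rewrite restrict_EFin.
have lf : locally_integrable setT f by exact: integrable_locally.
have F0 x : (\int[mu]_(t in `]-oo, x]) f t)%R = 0.
  rewrite /f -Rintegral_mkcondr.
  have [x0|x0] := leP x 0.
    rewrite (_ : _ `&` _ = set0) ?Rintegral_set0//.
    by apply/seteqP; split=> // t []/=; rewrite !in_itv/=; lra.
  have m0 : 0 < Num.min x 1 by rewrite lt_min x0 ltr01.
  have m1 : Num.min x 1 <= 1 by rewrite ge_min lexx orbT.
  have c0 : {within `[(0 : R), 1], continuous (fun=> 0 : R)}.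
    by apply: continuous_subspaceT => t; exact: cvg_cst.
  have := weak_FTC c0 g0 (lexx 0) m0 m1; rewrite subrr => gm.
  apply: etrans gm; rewrite /dot0; under [RHS]eq_Rintegral => t _.
    have -> : g t * \1_`[0, Num.min x 1] t = (g \_ `[0, Num.min x 1]%classic) t.
      by rewrite indicE patchE; case: ifPn; rewrite ?mulr1 ?mulr0.
    over.
  rewrite -Rintegral_mkcondr; congr (Rintegral _ _ _).
  apply/seteqP; split=> t []/=; rewrite !in_itv/= ?le_min => ? ?; split; lra.
have fy y : mu.-integrable `]-oo, y] (EFin \o f) by exact: integrableS intf.
have := @FTC1Ny R f fy lf; rewrite /=.
have -> : (fun x => (\int[mu]_(t in `]-oo, x]) f t)%R) = cst 0 by apply/funext.
apply: (@filterS _ _ (ae_filter_ringOfSetsType mu)) => x [_].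
by rewrite derive1_cst /f patchE => fx xI; rewrite mem_set in fx.
Qed.

Lemma div1_0 : is_weak_deriv (fun=> 0 : R) (div1 (fun=> 0)).
Proof.
rewrite /div1; case: xgetP => [g -> //|/(_ (fun=> 0))[]]; split; first exact: L2_cst.
by move=> phi _; rewrite /dot0; under eq_Rintegral do rewrite mul0r;
  under [in RHS]eq_Rintegral do rewrite mul0r; rewrite Rintegral_cst// mul0r oppr0.
Qed.

Lemma dot0_div1_0 v : measurable_fun `](0 : R), 1[ v -> dot0 (div1 (fun=> 0)) v = 0.
Proof.
move=> mv; have [[mg _] _] := div1_0.
rewrite /dot0 /Rintegral (@ae_eq_integral _ _ _ mu _ (cst 0%E)) ?integral0//.
- by apply/measurable_EFinP; apply: measurable_funM.
- apply: (@filterS _ _ (ae_filter_ringOfSetsType mu) _ _ _ (weak_deriv0_ae div1_0)) => x gx xI.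
  by rewrite gx// mul0r.
Qed.

End weak_derivative.

(** * Meshes and discrete spaces *)

Section meshes.
Context {R : realType}.
Implicit Types (T : mesh R) (psi q v : R -> R).

Lemma mesh_le T i j : (i <= j <= nelt T)%N -> vtx T i <= vtx T j.
Proof.
case/andP; elim: j => [|j IH]; first by rewrite leqn0 => /eqP->.
rewrite leq_eqVlt => /predU1P[-> //|]; rewrite ltnS => ij jn.
by rewrite (le_trans (IH ij (ltnW jn)))// ltW// vtx_lt.
Qed.

Lemma mesh_lt T i j : (i < j <= nelt T)%N -> vtx T i < vtx T j.
Proof.
move=> /andP[ij jn]; apply: (lt_le_trans (vtx_lt (leq_trans ij jn))).
by apply: mesh_le; rewrite ij.
Qed.

Lemma hstep_gt0 T j : (j < nelt T)%N -> 0 < hstep T j.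
Proof. by move=> jn; rewrite subr_gt0 vtx_lt. Qed.

(** Induction along the elements, used to pass from each element to [0,1] both
    for measurability and for continuity. *)
Lemma mesh_glue T (P : set R -> Prop) :
  (forall a b c : R, a <= b <= c -> P `[a, b]%classic -> P `[b, c]%classic ->
    P (`[a, b] `|` `[b, c])) ->
  (forall j, (j < nelt T)%N -> P `[vtx T j, vtx T j.+1]%classic) ->
  P `[0, 1]%classic.
Proof.
move=> PU Pe; rewrite -(vtx_first T) -(vtx_last T).
have := leqnn (nelt T); have := nelt_gt0 T; move: {1 2 4}(nelt T) => [//|m _].
elim: m => [|m IH] mn; first exact: Pe.
have le1 : vtx T 0 <= vtx T m.+1 by apply: mesh_le; rewrite leq0n ltnW.
have le2 : vtx T m.+1 <= vtx T m.+2 by rewrite ltW// vtx_lt.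
rewrite (_ : `[_, _]%classic =
  `[vtx T 0, vtx T m.+1]%classic `|` `[vtx T m.+1, vtx T m.+2]%classic).
  by apply: PU; [rewrite le1|exact: IH (ltnW mn)|exact: Pe].
by apply/seteqP; split=> x /=; rewrite !in_itv/=; [|case];
  case: (leP x (vtx T m.+1)); lra.
Qed.

(** A function of U is arbitrary at the vertices, which does not affect
    measurability: they are finitely many. *)
Lemma U_space_measurable T v : U_space T v -> measurable_fun `](0 : R), 1[ v.
Proof.
move=> Uv; apply: (@measurable_funS _ _ _ _ `[(0 : R), 1]) => //.
  exact: subset_itv_oo_cc.
apply: (@mesh_glue T (fun A => measurable_fun A v)) => [a b c _ ma mb|j jn].
  by apply/measurable_funU.
have [c vc] := Uv j jn.
apply: (@measurable_fun_itv_cc _ _ _ false true).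
apply: (@eq_measurable_fun _ _ _ _ _ (cst c)) => // x.
by rewrite inE/= => xj; rewrite vc.
Qed.

(** Only the two basis functions attached to the ends of an element live on
    it.  At a vertex, the two branches of its own basis function both give
    psi 1, while those of the neighbouring vertices give psi 0 = 0. *)
Lemma psi_basis_element psi T j k x : psi 0 = 0 -> (j < nelt T)%N -> (k <= nelt T)%N ->
  x \in `[vtx T j, vtx T j.+1] ->
  psi_basis psi T k x = (k == j)%:R * psi ((vtx T j.+1 - x) / hstep T j) +
                        (k == j.+1)%:R * psi ((x - vtx T j) / hstep T j).
Proof.
move=> psi0 jn kn; rewrite in_itv/= => /andP[xj jx]; rewrite /psi_basis.
have [-> {k kn}|kj1] := eqVneq k j.+1.
  by rewrite /= xj jx gtn_eqF// mul0r add0r mul1r.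
rewrite mul0r addr0; have [kj|kj] := eqVneq k j; subst => /=.
  rewrite jn xj jx mul1r/=; case: ifPn => // /and3P[j0 x1 x2].
  have xE : x = vtx T j by apply/eqP; rewrite eq_le x2.
  have h0 : 0 < vtx T j - vtx T j.-1 by rewrite subr_gt0 mesh_lt//; lia.
  have h1 : 0 < vtx T j.+1 - vtx T j := hstep_gt0 jn.
  by rewrite xE /hstep prednK// !divff ?gt_eqF.
rewrite mul0r; case: ifPn => [/and3P[k0 x1 x2]|_].
  have [kj'|jk] := ltnP k j.+1.
    have : vtx T k < vtx T j by apply: mesh_lt; lia.
    lra.
  have : vtx T j.+1 <= vtx T k.-1 by apply: mesh_le; lia.
  move=> h; rewrite (_ : x = vtx T k.-1) ?subrr ?mul0r//; lra.
case: ifPn => // /and3P[k0 x1 x2].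
have [kj'|jk] := ltnP k j.+1; last first.
  have : vtx T j.+1 < vtx T k by apply: mesh_lt; lia.
  lra.
have : vtx T k.+1 <= vtx T j by apply: mesh_le; lia.
move=> h; rewrite (_ : x = vtx T k.+1) ?subrr ?mul0r//; lra.
Qed.

Lemma Q_space_element psi T q : psi 0 = 0 -> Q_space psi T q ->
  exists c : nat -> R, forall j x, (j < nelt T)%N -> x \in `[vtx T j, vtx T j.+1] ->
  q x = c j * psi ((vtx T j.+1 - x) / hstep T j) +
        c j.+1 * psi ((x - vtx T j) / hstep T j).
Proof.
(* Indices beyond nelt T are sent by inord to an arbitrary coefficient. *)
move=> psi0 [c qc]; exists (c \o inord) => j x jn xj.
have x01 : x \in `[(0 : R), 1].
  move: xj; rewrite -(vtx_first T) -(vtx_last T) !in_itv/=.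
  have := @mesh_le T 0 j; have := @mesh_le T j.+1 (nelt T).
  rewrite jn leqnn leq0n (ltnW jn) => /(_ isT) + /(_ isT); lra.
rewrite qc//.
under eq_bigr => k _.
  rewrite (psi_basis_element psi0 jn _ xj) -1?ltnS// mulrDr.
  over.
rewrite big_split/=; congr (_ + _).
  rewrite (bigD1 (inord j))//= big1 ?addr0 ?inordK ?eqxx ?mul1r// 1?ltnW//.
  move=> k kj; rewrite (_ : (_ == _) = false) ?mul0r ?mulr0//.
  by apply: contra_neqF kj => /eqP <-; rewrite inord_val.
rewrite (bigD1 (inord j.+1))//= big1 ?addr0 ?inordK ?eqxx ?mul1r// 1?ltnW//.
move=> k kj; rewrite (_ : (_ == _) = false) ?mul0r ?mulr0//.
by apply: contra_neqF kj => /eqP <-; rewrite inord_val.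
Qed.

Lemma within_continuous_comp psi (g : R -> R) (A B : set R) :
  {within B, continuous psi} -> continuous g -> (forall x, A x -> B (g x)) ->
  {within A, continuous (psi \o g)}.
Proof.
move=> /subspace_continuousP pc gc AB; apply/subspace_continuousP => x Ax.
apply: cvg_comp (pc (g x) (AB x Ax)) => U BU.
have nU : nbhs x (g @^-1` [set t | B t -> U t]) := gc x _ BU.
suff : nbhs x [set y | A y -> U (g y)] by [].
by apply: filterS nU => y yU Ay; exact: yU (AB _ Ay).
Qed.

Lemma Q_space_continuous psi T q : {within `[(0 : R), 1], continuous psi} ->
  psi 0 = 0 -> Q_space psi T q -> {within `[(0 : R), 1], continuous q}.
Proof.
move=> pc psi0 /(Q_space_element psi0)[c qc].
apply: (@mesh_glue T (fun A => {within A, continuous q})) => [a b d _ ca cb|j jn].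
  by apply: withinU_continuous => //; exact: interval_closed.
have h0 := hstep_gt0 jn.
pose g1 x := (vtx T j.+1 - x) / hstep T j.
pose g2 x := (x - vtx T j) / hstep T j.
have c1 : continuous g1.
  move=> x; apply: cvgM; last exact: cvg_cst.
  by apply: cvgB; [exact: cvg_cst|exact: cvg_id].
have c2 : continuous g2.
  move=> x; apply: cvgM; last exact: cvg_cst.
  by apply: cvgB; [exact: cvg_id|exact: cvg_cst].
have m1 x : `[vtx T j, vtx T j.+1]%classic x -> `[(0:R), 1]%classic (g1 x).
  move=> /=; rewrite !in_itv/= => /andP[? ?]; rewrite /g1 ler_pdivrMr// mul1r.
  by apply/andP; split; [apply: divr_ge0; lra|rewrite /hstep; lra].
have m2 x : `[vtx T j, vtx T j.+1]%classic x -> `[(0:R), 1]%classic (g2 x).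
  move=> /=; rewrite !in_itv/= => /andP[? ?]; rewrite /g2 ler_pdivrMr// mul1r.
  by apply/andP; split; [apply: divr_ge0; lra|rewrite /hstep; lra].
apply: (@subspace_eq_continuous _ _ _ (fun x => c j * psi (g1 x) + c j.+1 * psi (g2 x))).
  by move=> x /set_mem xj; exact/esym/qc.
have w1 := within_continuous_comp pc c1 m1; have w2 := within_continuous_comp pc c2 m2.
move=> x; apply: cvgD; apply: cvgM; try exact: cvg_cst.
  exact: w1.
exact: w2.
Qed.

Definition uniform_mesh (n : nat) : mesh R.
Proof.
apply: (@Mesh R n.+1 (fun j => j%:R / n.+1%:R)) => [//|||j _].
- by rewrite mul0r.
- by rewrite divff// pnatr_eq0.
- by rewrite ltr_pM2r ?invr_gt0 ?ltr0n// ltr_nat.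
Defined.

Lemma hstep_uniform n j : hstep (uniform_mesh n) j = n.+1%:R^-1.
Proof. by rewrite /hstep/= -mulrBl -natrB// subSnn mul1r. Qed.

Lemma unif_regular_uniform (alpha beta : R) n : alpha <= 1 -> 1 <= beta ->
  unif_regular alpha beta (uniform_mesh n).
Proof.
move=> a1 b1 j _; rewrite hstep_uniform /=.
have n0 : (0 : R) < n.+1%:R by rewrite ltr0n.
by rewrite ler_pdivrMr// ler_pdivlMr// mulVf ?gt_eqF// a1.
Qed.

End meshes.

(** * Functions of the Petrov-Galerkin space at the vertices *)

Section vertex_bound.
Context {R : realType}.
Implicit Types (q g psi : R -> R) (a b : R).

(** The sum q(a) + q(b) is controlled because adding the values of q at two
    points symmetric about the centre of [a,b] multiplies it by
    psi(theta) + psi(1-theta), whereas the Hoelder estimate says that this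
    factor acts almost like 1; the difference q(a) - q(b) is controlled by the
    Hoelder estimate directly.  The two terms of K are their contributions to
    q(a) and q(b), the half difference and the half sum. *)
Lemma endpoint_bound psi q g theta a b (c1 c2 : R) :
  psi 0 = 0 -> psi 1 = 1 -> 0 < theta < 1 -> psi theta + psi (1 - theta) <> 1 ->
  {within `[(0 : R), 1], continuous q} -> is_weak_deriv q g ->
  0 <= a -> a < b -> b <= 1 ->
  (forall x, x \in `[a, b] ->
    q x = c1 * psi ((b - x) / (b - a)) + c2 * psi ((x - a) / (b - a))) ->
  let K := 2^-1 + `|psi theta + psi (1 - theta) - 1|^-1 in
  `|q a| <= K * (norm0 g * Num.sqrt (b - a)) /\
  `|q b| <= K * (norm0 g * Num.sqrt (b - a)).
Proof.
move=> psi0 psi1 th01 thN1 qc qg a0 ab b1 qE K.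
have osc x y := weak_deriv_holder qc qg a0 b1 (x := x) (y := y).
set e := norm0 g * _ in osc *.
have h0 : b - a != 0 by rewrite subr_eq0 gt_eqF.
pose s := psi theta + psi (1 - theta) - 1.
have s0 : 0 < `|s| by rewrite normr_gt0 subr_eq0; apply/eqP.
have aI : a \in `[a, b] by rewrite in_itv/= lexx ltW.
have bI : b \in `[a, b] by rewrite in_itv/= lexx ltW.
pose x1 := a + theta * (b - a); pose x2 := b - theta * (b - a).
have x1I : x1 \in `[a, b] by rewrite in_itv/= /x1; nra.
have x2I : x2 \in `[a, b] by rewrite in_itv/= /x2; nra.
have qa : q a = c1 by rewrite qE// subrr mul0r divff// psi0 psi1; ring.
have qb : q b = c2 by rewrite qE// subrr mul0r divff// psi0 psi1; ring.
have q1 : q x1 = c1 * psi (1 - theta) + c2 * psi theta.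
  by rewrite qE//; congr (_ * psi _ + _ * psi _); rewrite /x1; field.
have q2 : q x2 = c1 * psi theta + c2 * psi (1 - theta).
  by rewrite qE//; congr (_ * psi _ + _ * psi _); rewrite /x2; field.
have E : (q a + q b) * s = (q x1 - q a) + (q x2 - q b).
  by rewrite q1 q2 qa qb /s; ring.
have e0 : 0 <= e by apply: le_trans (osc a b aI bI).
have sum_le : `|q a + q b| <= 2 * e / `|s|.
  rewrite ler_pdivlMr// -normrM E mulr_natl mulr2n.
  by apply: le_trans (ler_normD _ _) _; rewrite lerD// osc.
have diff_le := osc a b aI bI.
have KE : K * e = 2^-1 * e + 2^-1 * (2 * e / `|s|).
  by rewrite /K -/s; field; rewrite gt_eqF.
rewrite KE; move: sum_le diff_le; move: (2 * e / `|s|) => S.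
by rewrite !ler_norml => ? ?; split; apply/andP; split; lra.
Qed.

Lemma vertex_bound psi (T : mesh R) q g theta j :
  psi 0 = 0 -> psi 1 = 1 -> 0 < theta < 1 -> psi theta + psi (1 - theta) <> 1 ->
  {within `[(0 : R), 1], continuous psi} -> Q_space psi T q -> is_weak_deriv q g ->
  (j < nelt T)%N ->
  let K := 2^-1 + `|psi theta + psi (1 - theta) - 1|^-1 in
  `|q (vtx T j)| <= K * (norm0 g * Num.sqrt (hstep T j)) /\
  `|q (vtx T j.+1)| <= K * (norm0 g * Num.sqrt (hstep T j)).
Proof.
move=> psi0 psi1 th01 thN1 psi_cont Qq qg jn.
have qc := Q_space_continuous psi_cont psi0 Qq.
have [c qE] := Q_space_element psi0 Qq.
apply: (endpoint_bound psi0 psi1 th01 thN1 qc qg _ (vtx_lt jn) _ (qE j ^~ jn)).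
- by rewrite -(vtx_first T) mesh_le// leq0n ltnW.
- by rewrite -(vtx_last T) mesh_le// jn leqnn.
Qed.

End vertex_bound.

(** * The pair (1, 0) violates the inf-sup condition *)

Section one_zero.
Context {R : realType}.

Lemma dot0_11 : dot0 (fun=> 1 : R) (fun=> 1) = 1.
Proof.
rewrite /dot0; under eq_Rintegral do rewrite mulr1.
by rewrite Rintegral_cst//= lebesgue_measure_itv/= lte_fin ltr01 mul1r/= subr0.
Qed.

Lemma dot0_0l (f : R -> R) : dot0 (fun=> 0) f = 0.
Proof. by rewrite /dot0; under eq_Rintegral do rewrite mul0r; rewrite Rintegral_cst// mul0r. Qed.

Lemma normV_10 : normV ((fun=> 1 : R), (fun=> 0)) = 1.
Proof.
rewrite /normV/= !norm0_sqr dot0_11 dot0_0l dot0_div1_0.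
  by rewrite !addr0 sqrtr1.
by have [[]] := @div1_0 R.
Qed.

Lemma dot0_indic01 (g : R -> R) : dot0 (fun=> 1) g = dot0 g \1_`[0, 1].
Proof.
apply: eq_Rintegral => x xI; rewrite indicE mem_set ?mul1r ?mulr1//=.
by apply: subset_itv_oo_cc; exact: set_mem xI.
Qed.

Lemma norm0_div1_le (eta : (R -> R) * (R -> R)) : norm0 (div1 eta.2) <= normV eta.
Proof.
rewrite -[leLHS]ger0_norm ?norm0_ge0// -sqrtr_sqr ler_wsqrtr//.
by rewrite lerDr addr_ge0// sqr_ge0.
Qed.

End one_zero.

Theorem theorem3 (R : realType) (psi : R -> R)
    (psi_cont : {within `[(0 : R), (1 : R)], continuous psi})
    (psi_H1 : H1 psi)
    (psi0 : psi 0 = 0)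
    (psi1 : psi 1 = 1)
    (psi_orth : (\int[lebesgue_measure]_(x in `[(0 : R), (1 : R)]) ((1 - x) * psi x))%R = 0)
    (psi_theta : exists2 theta : R,
       0 < theta < 1 & psi theta + psi (1 - theta) <> 1) :
  forall alpha beta : R, 0 < alpha -> alpha < 1 -> 1 < beta ->
  forall D : R, 0 < D ->
  exists2 T : mesh R, unif_regular alpha beta T &
  exists xi : (R -> R) * (R -> R),
    [/\ (U_space T `*` P_space T) xi,
        normV xi = 1
      & forall eta : (R -> R) * (R -> R),
          (U_space T `*` Q_space psi T) eta ->
          normV eta <= 1 -> gamma_form xi eta <= D].
Proof.
move=> alpha beta a0 a1 b1 D D0; have [theta th01 thN1] := psi_theta.
pose K := 2^-1 + `|psi theta + psi (1 - theta) - 1|^-1.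
have K0 : 0 < K by rewrite /K; apply: ltr_pwDl; rewrite ?invr_gt0 ?invr_ge0.
(* sqrt h must be below D / (2 K), where h = 1 / n.+1. *)
pose n := Num.bound ((2 * K / D) ^+ 2).
pose T : mesh R := uniform_mesh n.
exists T; first exact: unif_regular_uniform (ltW a1) (ltW b1).
have small : K * Num.sqrt n.+1%:R^-1 <= D / 2.
  rewrite -ler_pdivlMl// -[leRHS]ger0_norm; last by rewrite mulr_ge0 ?invr_ge0 ?divr_ge0 ?ltW.
  rewrite -sqrtr_sqr ler_wsqrtr//.
  have N0 : 0 < (2 * K / D) ^+ 2 by rewrite exprn_gt0// divr_gt0// mulr_gt0.
  have -> : K^-1 * (D / 2) = (2 * K / D)^-1 by field; rewrite !gt_eqF.
  rewrite exprVn lef_pV2 ?posrE ?ltr0n//.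
  by apply: ltW; apply: lt_le_trans (archi_boundP (ltW N0)) _; rewrite ler_nat.
exists ((fun=> 1), (fun=> 0)); split.
- split=> /=; first by move=> j _; exists 1.
  split; first by apply: continuous_subspaceT => t; exact: cvg_cst.
  by move=> j _; exists 0, 0 => x _; rewrite mul0r addr0.
- exact: normV_10.
move=> [v q] [/= Uv Qq] eta1.
rewrite /gamma_form/= dot0_0l add0r dot0_div1_0 ?addr0; last exact: U_space_measurable Uv.
(* Without a weak derivative div1 q is the zero function. *)
have [[g0 qg0]|nog] := pselect (exists g, is_weak_deriv q g); last first.
  rewrite /div1 xgetPN; last by move=> g qg; apply: nog; exists g.
  by rewrite /dot0; under eq_Rintegral do rewrite mulr0; rewrite Rintegral_cst// mul0r ltW.
have qg : is_weak_deriv q (div1 q) by apply: xgetPex; exists g0.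
have g1 : norm0 (div1 q) <= 1 by apply: le_trans eta1; exact: (norm0_div1_le (v, q)).
have qc := Q_space_continuous psi_cont psi0 Qq.
rewrite dot0_indic01 (weak_FTC qc qg)//.
have vertex j : (j < nelt T)%N ->
    `|q (vtx T j)| <= D / 2 /\ `|q (vtx T j.+1)| <= D / 2.
  move=> jn; have := vertex_bound psi0 psi1 th01 thN1 psi_cont Qq qg jn.
  rewrite /T hstep_uniform => -[A B].
  suff le : K * (norm0 (div1 q) * Num.sqrt n.+1%:R^-1) <= D / 2.
    by split; [exact: le_trans A le|exact: le_trans B le].
  apply: le_trans small; rewrite ler_pM2l//.
  by apply: ler_piMl; rewrite ?sqrtr_ge0.
have [q0 _] := vertex 0%N isT.
have [_ q1] := vertex n (ltnSn n).
move: q0 q1; rewrite (vtx_first T) (vtx_last T).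
by rewrite !ler_norml; lra.
Qed.
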